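(* Let $f(x,y)=1+x+y+x^2y^3+x^3y^2+x^3y^3\in\mathbb{Q}[x,y]$. Let $\alpha=e^{2\pi i/3}$, $\beta=e^{2\pi i/5}$, $\gamma=e^{2\pi i/7}$, and define \[ S_0=\{(1,-1),(-1,1)\}, \] \[ S_1=\{(\alpha,\alpha),(\alpha^2,\alpha),(\alpha,\alpha^2),(\alpha^2,\alpha^2),(\alpha,-\alpha),(-\alpha,\alpha),(\alpha^2,-\alpha^2),(-\alpha^2,\alpha^2)\}, \] \[ S_2=\{(\beta^j\alpha,\beta^j\alpha^2),\ (\beta^j\alpha^2,\beta^j\alpha)\ :\ j=1,2,3,4\}, \] \[ \begin{aligned} S_3=\{&(\gamma,-\gamma^4),(\gamma^2,-\gamma),(\gamma^3,-\gamma^5),(\gamma^4,-\gamma^2),(\gamma^5,-\gamma^6),(\gamma^6,-\gamma^3),\\ &(-\gamma,\gamma^2),(-\gamma^2,\gamma^4),(-\gamma^3,\gamma^6),(-\gamma^4,\gamma),(-\gamma^5,\gamma^3),(-\gamma^6,\gamma^5)\}, \end{aligned} \] and $S=S_0\cup S_1\cup S_2\cup S_3$ (a set of $30$ pairs). Then the set of all pairs $(x,y)\in\mathbb{C}^2$ such that $f(x,y)=0$ and $x^N=y^N=1$ for some positive integer $N$ is exactly $S$. *)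

(* Defs.v *)
From mathcomp Require Import all_boot all_order all_algebra.
From mathcomp Require Import complex polyXY.
From mathcomp Require Import all_classical all_reals all_analysis.

Import Order.TTheory GRing.Theory Num.Theory.

Local Open Scope classical_set_scope.
Local Open Scope ring_scope.
Local Open Scope complex_scope.

(* Q[x,y] is encoded as {poly {poly rat}}, with x = 'X the outer variable and
   y = 'Y (= 'X%:P) the inner one; u.[x, y] evaluates 'X at x and 'Y at y. *)
Definition f : {poly {poly rat}} :=
  1 + 'X + 'Y + 'X ^+ 2 * 'Y ^+ 3 + 'X ^+ 3 * 'Y ^+ 2 + 'X ^+ 3 * 'Y ^+ 3.

Definition f_eval {R : realType} (x y : R[i]) : R[i] :=
  (map_poly (map_poly ratr) f).[x, y].

Definition cexp {R : realType} (z : R[i]) : R[i] :=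
  (expR (complex.Re z))%:C * (cos (complex.Im z) +i* sin (complex.Im z)).

Definition alpha (R : realType) : R[i] := cexp (0 +i* (2 * pi / 3)).
Definition beta (R : realType) : R[i] := cexp (0 +i* (2 * pi / 5)).
Definition gamma (R : realType) : R[i] := cexp (0 +i* (2 * pi / 7)).

Definition S0 (R : realType) : set (R[i] * R[i]) :=
  [set (1, -1); (-1, 1)].

Definition S1 (R : realType) : set (R[i] * R[i]) :=
  let a := alpha R in
  [set (a, a); (a ^+ 2, a); (a, a ^+ 2); (a ^+ 2, a ^+ 2);
       (a, - a); (- a, a); (a ^+ 2, - a ^+ 2); (- a ^+ 2, a ^+ 2)].

Definition S2 (R : realType) : set (R[i] * R[i]) :=
  let a := alpha R in
  let b := beta R in
  \bigcup_(j in [set j : nat | (1 <= j <= 4)%N])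
    [set (b ^+ j * a, b ^+ j * a ^+ 2); (b ^+ j * a ^+ 2, b ^+ j * a)].

Definition S3 (R : realType) : set (R[i] * R[i]) :=
  let c := gamma R in
  [set (c, - c ^+ 4); (c ^+ 2, - c); (c ^+ 3, - c ^+ 5);
       (c ^+ 4, - c ^+ 2); (c ^+ 5, - c ^+ 6); (c ^+ 6, - c ^+ 3);
       (- c, c ^+ 2); (- c ^+ 2, c ^+ 4); (- c ^+ 3, c ^+ 6);
       (- c ^+ 4, c); (- c ^+ 5, c ^+ 3); (- c ^+ 6, c ^+ 5)].

Definition torsionS (R : realType) : set (R[i] * R[i]) :=
  S0 R `|` S1 R `|` S2 R `|` S3 R.

(* Main.v *)
(* A torsion zero [(x, y)] makes a sum of six monomials, all roots of unity,
   vanish.  Let [n] be the least common exponent of [x] and [y].  If a prime [p]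
   divides [n] and either [p ^ 2] divides [n] or [p > 6], Mann's Galois argument
   splits the sum, according to the residues modulo [p] of the exponents of a
   primitive [n]-th root, into vanishing subsums, and minimality of [n] makes the
   splitting proper; otherwise [n] divides [30].  Vanishing sums of at most four
   complex numbers of modulus 1 are explicit (opposite pairs, or triples with
   equal cubes), so a proper splitting gives monomial relations that force
   [x ^+ m = y ^+ m = 1] with [m = 60] or [m = 14].  The zeros of these orders are
   found by reducing modulo a prime with a primitive [m]-th root of unity. *)
Require Import Defs.
From mathcomp Require Import all_boot all_order all_algebra.
From mathcomp Require Import complex polyXY.
From mathcomp Require Import all_classical all_reals all_analysis.
From mathcomp Require Import algC cyclotomic ring.

Import Order.TTheory GRing.Theory Num.Theory.

Local Open Scope ring_scope.

Set Implicit Arguments.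
Unset Strict Implicit.
Unset Printing Implicit Defensive.

(** * Cyclotomic polynomials and transfer of vanishing sums between domains *)

Lemma prim_root_intro (F : nzRingType) n (z : F) :
  (0 < n)%N -> z ^+ n = 1 ->
  (forall k, (0 < k < n)%N -> z ^+ k != 1) -> n.-primitive_root z.
Proof.
move=> n_gt0 zn1 zk; rewrite /primitive_root_of_unity n_gt0 /=; apply/forallP => i.
rewrite unity_rootE; have [->|ne] := eqVneq i.+1 n; first by rewrite zn1 eqxx.
by rewrite (negbTE (zk _ _)) //= ltn_neqAle ne ltn_ord.
Qed.

(** Since [X^n - 1] is the product of the ['Phi_d] with [d] dividing [n], some such ['Phi_d] kills
    [z]; then [z ^+ d = 1] forces [d = n]. The argument holds in any characteristic, hence in
    ['F_p]. *)
Lemma root_Cyclotomic_prim (F : idomainType) n (z : F) :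
  n.-primitive_root z -> root (map_poly intr 'Phi_n) z.
Proof.
move=> prim_z; have n_gt0 := prim_order_gt0 prim_z.
have evalP m : (0 < m)%N ->
    \prod_(d <- divisors m) (map_poly intr 'Phi_d).[z] = z ^+ m - 1.
  move=> m_gt0; rewrite -horner_prod -rmorph_prod prod_Cyclotomic //.
  by rewrite rmorphB rmorphXn /= map_polyX rmorph1 !hornerE.
have := evalP _ n_gt0; rewrite (prim_expr_order prim_z) subrr => /eqP.
rewrite prodf_seq_eq0 => /hasP[d]; rewrite -dvdn_divisors //= => d_n Phi0.
have d_gt0 := dvdn_gt0 n_gt0 d_n.
suff <- : d = n by [].
apply/eqP; rewrite eqn_dvd d_n (prim_order_dvd prim_z) /= -subr_eq0 -evalP //.
by rewrite prodf_seq_eq0; apply/hasP; exists d; rewrite -?dvdn_divisors.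
Qed.

(* The integral form of the irreducibility of the cyclotomic polynomials. *)
Lemma Cyclotomic_dvd (C : numFieldType) n (z : C) (q : {poly int}) :
  n.-primitive_root z -> root (map_poly intr q) z ->
  exists h, q = h * 'Phi_n.
Proof.
move=> prim_z qz0; have n_gt0 := prim_order_gt0 prim_z.
have [w prim_w] := C_prim_root_exists n_gt0.
pose ZQ := map_poly (intr : int -> rat).
have ratrZ (F : numFieldType) (r : {poly int}) :
    map_poly (ratr : rat -> F) (ZQ r) = map_poly intr r.
  by rewrite /ZQ -map_poly_comp; apply: eq_map_poly => i /=; rewrite ratr_int.
have Phiz0 : root (map_poly (ratr : rat -> C) (ZQ 'Phi_n)) z.
  by rewrite ratrZ; apply: root_Cyclotomic_prim.
have dvdQ : ZQ 'Phi_n %| ZQ q.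
  (* A Bezout identity over the rationals, evaluated at [z], would read [0 = 1]. *)
  have [/Bezout_eq1_coprimepP[[u v] /= uvE]|] :=
      boolP (coprimep (ZQ 'Phi_n) (ZQ q)).
    have := congr1 (fun p => (map_poly (ratr : rat -> C) p).[z]) uvE.
    rewrite rmorphD !rmorphM rmorph1 /= !hornerE (rootP Phiz0) ratrZ (rootP qz0).
    by rewrite !mulr0 addr0 => /esym/eqP; rewrite oner_eq0.
  (* A common root [t] in [algC] is a primitive [n]-th root, whose minimal polynomial is
     ['Phi_n]. *)
  rewrite /coprimep => sz.
  have /closed_rootP[t] :
      size (map_poly (ratr : rat -> algC) (gcdp (ZQ 'Phi_n) (ZQ q))) != 1%N.
    by rewrite size_map_poly.
  rewrite gcdp_map root_gcd => /andP[Phit0 qt0].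
  have prim_t : n.-primitive_root t.
    by move: Phit0; rewrite ratrZ (Cintr_Cyclotomic prim_w) root_cyclotomic.
  have [m [Dm _] mP] := minCpolyP t.
  suff <- : m = ZQ 'Phi_n by rewrite -mP.
  apply: (map_poly_inj (ratr : {rmorphism rat -> algC})).
  by rewrite /= ratrZ (Cintr_Cyclotomic prim_t) -(minCpoly_cyclotomic prim_t) Dm.
(* As ['Phi_n] is monic, division with remainder stays over the integers; the remainder vanishes by
   degree. *)
have Phi_monic := Cyclotomic_monic n.
have DE := Pdiv.RingMonic.rdivp_eq Phi_monic q.
set h := Pdiv.Ring.rdivp _ _ in DE; set r := Pdiv.Ring.rmodp _ _ in DE.
have r_lt : (size r < size 'Phi_n)%N.
  by rewrite Pdiv.Ring.ltn_rmodpN0 // monic_neq0.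
exists h; rewrite [LHS]DE; suff -> : r = 0 by rewrite addr0.
have szZQ (p : {poly int}) : size (ZQ p) = size p.
  by rewrite size_map_inj_poly ?rmorph0 //; apply: intr_inj.
have : ZQ 'Phi_n %| ZQ r.
  by move: dvdQ; rewrite DE /ZQ rmorphD rmorphM /= dvdp_addr // dvdp_mull.
move=> /dvdp_leq; rewrite !szZQ leqNgt r_lt -size_poly_eq0 szZQ size_poly_eq0.
by case: eqVneq => // _ /(_ isT).
Qed.

(** By [Cyclotomic_dvd] the sum comes from a multiple of ['Phi_n], which vanishes at [w] too. It
    serves with [w] a conjugate of [z] and with [w] in a prime field. *)
Lemma prim_root_sum_transfer (C : numFieldType) (F : idomainType) n
    (z : C) (w : F) (s : seq nat) :
  n.-primitive_root z -> n.-primitive_root w ->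
  \sum_(e <- s) z ^+ e = 0 -> \sum_(e <- s) w ^+ e = 0.
Proof.
move=> prim_z prim_w z0.
have evalE (A : comNzRingType) (t : A) :
    (map_poly intr (\sum_(e <- s) 'X^e)).[t] = \sum_(e <- s) t ^+ e.
  rewrite rmorph_sum horner_sum; apply: eq_bigr => e _.
  by rewrite /= map_polyXn hornerXn.
have [|h Dh] := @Cyclotomic_dvd _ _ z (\sum_(e <- s) 'X^e) prim_z.
  by rewrite rootE evalE z0.
rewrite -evalE Dh rmorphM hornerM.
by rewrite (rootP (root_Cyclotomic_prim prim_w)) mulr0.
Qed.

(** * Mann's reduction modulo a prime *)

Lemma sum_expr_root_unity (F : idomainType) p (v : F) :
  v ^+ p = 1 -> \sum_(j < p) v ^+ j = if v == 1 then p%:R else 0.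
Proof.
move=> vp1; case: eqP => [->|/eqP v_neq1].
  under eq_bigr do rewrite expr1n.
  by rewrite sumr_const card_ord.
apply/eqP; move: (subrX1 v p); rewrite vp1 subrr => /esym/eqP.
by rewrite mulf_eq0 subr_eq0 (negbTE v_neq1).
Qed.

(* Mann's reduction.  The conjugates of [z] over the field of [z ^+ p] are the
   [z * w ^+ j] with [w] of order [p], except for at most one value of [j]; the
   sums over the residue classes are the Fourier coefficients of the conjugate
   relations. *)
Lemma vanishing_sum_residue_class (C : numFieldType) n p (z : C)
    (s : seq nat) (r : nat) :
  prime p -> n.-primitive_root z -> (p %| n)%N ->
  (p %| n %/ p)%N || (size s < p)%N ->
  \sum_(e <- s) z ^+ e = 0 ->
  \sum_(e <- s | (e == r %[mod p])%N) z ^+ e = 0.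
Proof.
move=> p_pr prim_z p_n p_large z0; pose m := (n %/ p)%N.
have p_gt0 := prime_gt0 p_pr; have nE : (m * p)%N = n by rewrite divnK.
pose w := z ^+ m; have prim_w : p.-primitive_root w by exact: dvdn_prim_root.
(* [T j] is the sum with [z] replaced by [z * w ^+ j = z ^+ (1 + j * m)]. *)
pose T j := \sum_(e <- s) z ^+ e * w ^+ (j * e).
have T_coprime j : coprime (1 + j * m) n -> T j = 0.
  rewrite -(prim_root_exp_coprime _ prim_z) => prim_zj.
  rewrite -(prim_root_sum_transfer prim_z prim_zj z0).
  by apply: eq_bigr => e _; rewrite -!exprM -exprD; congr (_ ^+ _); ring.
have fourier k : \sum_(j < p) w ^+ (j * (p - k %% p)) * T j =
    p%:R * \sum_(e <- s | (e == k %[mod p])%N) z ^+ e.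
  under eq_bigr do rewrite mulr_sumr.
  rewrite exchange_big mulr_sumr [RHS]big_mkcond; apply: eq_bigr => e _ /=.
  have -> : \sum_(j < p) w ^+ (j * (p - k %% p)) * (z ^+ e * w ^+ (j * e)) =
      z ^+ e * \sum_(j < p) (w ^+ (p - k %% p + e)) ^+ j.
    rewrite mulr_sumr; apply: eq_bigr => j _.
    by rewrite mulrCA -exprD -exprM; congr (_ * _ ^+ _); ring.
  rewrite sum_expr_root_unity; last first.
    by rewrite -exprM mulnC exprM (prim_expr_order prim_w) expr1n.
  rewrite -(prim_order_dvd prim_w).
  have -> : (p %| p - k %% p + e)%N = (e == k %[mod p])%N.
    rewrite -(eqn_modDl (p - k %% p)%N) -[in RHS](modnDmr _ k).
    by rewrite subnK ?modnn // ltnW ?ltn_pmod.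
  by case: ifP; rewrite ?mulr0 // mulrC.
suff T0 j : (j < p)%N -> T j = 0.
  apply/eqP; have := fourier r; rewrite big1 => [/esym/eqP|j _]; last first.
    by rewrite T0 ?mulr0.
  by rewrite mulf_eq0 pnatr_eq0 -leqn0 leqNgt p_gt0.
(* [1 + i * m] is always prime to [m], and [n = m * p], so only [p] has to be excluded. *)
have coprimeE i : ~~ (p %| 1 + i * m)%N -> coprime (1 + i * m) n.
  move=> pNi; rewrite -nE coprimeMr; apply/andP; split.
    by rewrite -coprime_modl addnC modnMDl coprime_modl coprime1n.
  by rewrite coprime_sym prime_coprime.
have [pm|pNm] := boolP (p %| m)%N.
  move=> _; apply/T_coprime/coprimeE.
  by rewrite dvdn_addl ?dvdn_mull // dvdn1 gtn_eqF ?prime_gt1.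
move: p_large; rewrite (negbTE pNm) /= => s_lt j_lt.
have [pj|/coprimeE/T_coprime //] := boolP (p %| 1 + j * m)%N.
(* At the exceptional [j], take a residue [k] met by no exponent, which exists as [size s < p]: the
   [k]-th Fourier identity then says that a nonzero multiple of [T j] vanishes. *)
have [k k_lt kP] : exists2 k, (k < p)%N & k \notin [seq e %% p | e <- s]%N.
  have : ~~ all (mem [seq e %% p | e <- s]%N) (iota 0 p).
    apply/negP => /allP /(uniq_leq_size (iota_uniq 0 p)).
    by rewrite size_iota size_map leqNgt s_lt.
  by case/allPn => k; rewrite mem_iota => /andP[_ k_lt] kP; exists k.
have := fourier k; rewrite (bigD1 (Ordinal j_lt)) //= big1 => [|i ne_ij].
  rewrite [in RHS]big_seq_cond big1 ?mulr0 ?addr0 => [/eqP|e /andP[e_s /eqP ek]].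
    rewrite mulf_eq0 expf_eq0 => /orP[/andP[_ w0]|/eqP//].
    have := prim_expr_order prim_w; rewrite (eqP w0) expr0n gtn_eqF //.
    by move/esym/eqP; rewrite oner_eq0.
  by case/mapP: kP; exists e; rewrite // ek modn_small.
rewrite T_coprime ?mulr0 //; apply: coprimeE; apply: contra ne_ij => pi.
have inj a b : (a <= b < p)%N -> (p %| 1 + a * m)%N -> (p %| 1 + b * m)%N ->
    a = b.
  move=> /andP[le_ab b_lt] pa pb.
  have := dvdn_sub pb pa; rewrite subnDl -mulnBl Euclid_dvdM // (negbTE pNm) orbF.
  move=> pba; apply/eqP; rewrite eqn_leq le_ab -subn_eq0 /=.
  apply: contraLR pba => ba; rewrite gtnNdvd ?lt0n //.
  exact: leq_ltn_trans (leq_subr _ _) b_lt.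
rewrite -val_eqE /=; case: (leqP i j) => [le_ij|/ltnW le_ji]; apply/eqP.
  by apply: inj; rewrite ?le_ij ?j_lt.
by apply/esym/inj; rewrite ?le_ji ?ltn_ord.
Qed.

(** * Vanishing sums of few numbers of modulus 1 *)

Definition monomial (A : nzRingType) (x y : A) (e : nat * nat) : A :=
  x ^+ e.1 * y ^+ e.2.

Definition f_exponents : seq (nat * nat) :=
  [:: (0, 0); (1, 0); (0, 1); (2, 3); (3, 2); (3, 3)]%N.

Lemma norm1_inv (C : numClosedFieldType) (u : C) : `|u| = 1 -> u^-1 = u^*.
Proof. by move=> u1; rewrite invC_norm u1 expr1n invr1 mul1r. Qed.

Lemma norm1_neq0 (C : numDomainType) (u : C) : `|u| = 1 -> u != 0.
Proof. by move=> u1; rewrite -normr_gt0 u1. Qed.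

(** Conjugation inverts numbers of modulus 1, so the second elementary symmetric function vanishes
    along with the first, and all three numbers are roots of [X^3 - u * v * w]. *)
Lemma norm1_sum3 (C : numClosedFieldType) (u v w : C) :
  `|u| = 1 -> `|v| = 1 -> `|w| = 1 -> u + v + w = 0 -> u ^+ 3 = v ^+ 3.
Proof.
move=> u1 v1 w1 uvw.
have := congr1 (fun t => t^*) uvw; rewrite !rmorphD rmorph0 /= -!norm1_inv //.
move/(congr1 (fun t => u * v * w * t)); rewrite mulr0.
have -> : u * v * w * (u^-1 + v^-1 + w^-1) = v * w + u * w + u * v.
  by field; rewrite !norm1_neq0.
move=> uvw'; have wE : w = - (u + v) by apply/eqP; rewrite -addr_eq0 addrC uvw.
apply/eqP; rewrite -subr_eq0; apply/eqP.
transitivity (- (u - v) * (v * w + u * w + u * v)); first by rewrite wE; ring.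
by rewrite uvw' mulr0.
Qed.

(** Here the first and third elementary symmetric functions vanish, and
    [(u + v) * (u + w) * (u + t)] is [u ^+ 2] times the first plus the third. *)
Lemma norm1_sum4 (C : numClosedFieldType) (u v w t : C) :
  `|u| = 1 -> `|v| = 1 -> `|w| = 1 -> `|t| = 1 -> u + v + w + t = 0 ->
  [\/ u = - v /\ w = - t, u = - w /\ v = - t | u = - t /\ v = - w].
Proof.
move=> u1 v1 w1 t1 uvwt.
have := congr1 (fun z => z^*) uvwt; rewrite !rmorphD rmorph0 /= -!norm1_inv //.
move/(congr1 (fun z => u * v * w * t * z)); rewrite mulr0.
have -> : u * v * w * t * (u^-1 + v^-1 + w^-1 + t^-1) =
    v * w * t + u * w * t + u * v * t + u * v * w.
  by field; rewrite !norm1_neq0.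
move=> e3; have /eqP : (u + v) * (u + w) * (u + t) = 0.
  transitivity (u ^+ 2 * (u + v + w + t) +
    (v * w * t + u * w * t + u * v * t + u * v * w)); first by ring.
  by rewrite uvwt e3 mulr0 addr0.
have split4 a b c d : a + b + c + d = 0 -> a + b = 0 -> a = - b /\ c = - d :> C.
  move=> abcd ab; split; apply/eqP; rewrite -addr_eq0 ?ab //.
  by rewrite -abcd ab add0r.
rewrite !mulf_eq0 => /orP[/orP[]|] /eqP h.
- by constructor 1; apply: split4.
- by constructor 2; apply: split4; rewrite // -uvwt; ring.
- by constructor 3; apply: split4; rewrite // -uvwt; ring.
Qed.

(* [(2, d, e)] stands for [m_d = - m_e] and [(3, d, e)] for [m_d ^+ 3 = m_e ^+ 3],
   where [m_e] is the monomial of exponent [e]. *)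
Definition relation := (nat * (nat * nat) * (nat * nat))%type.

(** For [k = 2] the sign is kept, rather than mere equality of squares, because
    [proper_split_torsion] refutes the exceptional pairing by signs. *)
Definition satisfies (A : nzRingType) (x y : A) (r : relation) : Prop :=
  let: (k, d, e) := r in
  if k == 2%N then monomial x y d = - monomial x y e
  else monomial x y d ^+ k = monomial x y e ^+ k.

(* Disjunction of the conjunctions of relations forced by the vanishing of the
   sum of the monomials of [s]; trivial for five monomials or more. *)
Definition forced_relations (s : seq (nat * nat)) : seq (seq relation) :=
  match s with
  | [:: _] => [::]
  | [:: a; b] => [:: [:: (2, a, b)]]
  | [:: a; b; c] => [:: [:: (3, a, b); (3, a, c)]]
  | [:: a; b; c; d] =>
      [:: [:: (2, a, b); (2, c, d)]; [:: (2, a, c); (2, b, d)];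
          [:: (2, a, d); (2, b, c)]]
  | _ => [:: [::]]
  end%N.

Section UnimodularRelations.

Variables (C : numClosedFieldType) (x y : C).
Hypotheses (x1 : `|x| = 1) (y1 : `|y| = 1).

Let mon := monomial x y.

Lemma norm_monomial e : `|mon e| = 1.
Proof. by rewrite normrM !normrX x1 y1 !expr1n mulr1. Qed.

Lemma forced_relationsP s : \sum_(e <- s) mon e = 0 ->
  exists2 r, r \in forced_relations s & {in r, forall q, satisfies x y q}.
Proof.
have n1 := norm_monomial.
case: s => [|a [|b [|c [|d [|e s]]]]]; rewrite ?big_cons ?big_nil ?addr0 => s0.
- by exists [::].
- by have /eqP := norm1_neq0 (n1 a).
- exists [:: (2, a, b)%N]; rewrite ?mem_head // => q; rewrite inE => /eqP-> /=.
  by apply/eqP; rewrite -addr_eq0 -/(mon _) -/(mon _) s0.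
- exists [:: (3, a, b); (3, a, c)]%N; rewrite ?mem_head // => q.
  rewrite !inE => /orP[] /eqP-> /=; rewrite -/(mon _) -/(mon _).
    by apply: norm1_sum3 (mon c) _ _ _ _; rewrite -?addrA.
  by apply: norm1_sum3 (mon b) _ _ _ _; rewrite // -addrA [mon c + _]addrC.
- rewrite !addrA in s0.
  have [[h1 h2]|[h1 h2]|[h1 h2]] := norm1_sum4 (n1 a) (n1 b) (n1 c) (n1 d) s0.
  + exists [:: (2, a, b); (2, c, d)]%N; rewrite ?inE ?eqxx // => q.
    by rewrite !inE => /orP[] /eqP->.
  + exists [:: (2, a, c); (2, b, d)]%N; rewrite ?inE ?eqxx ?orbT // => q.
    by rewrite !inE => /orP[] /eqP->.
  + exists [:: (2, a, d); (2, b, c)]%N; rewrite ?inE ?eqxx ?orbT // => q.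
    by rewrite !inE => /orP[] /eqP->.
- by exists [::].
Qed.

End UnimodularRelations.

(** * Bounding the order from monomial relations *)

Definition cramer_det (r s : relation) : nat :=
  let: (_, a, b) := r in let: (_, c, d) := s in
  absz ((a.1%:Z - b.1%:Z) * (c.2%:Z - d.2%:Z)
    - (c.1%:Z - d.1%:Z) * (a.2%:Z - b.2%:Z))%R.

(** Multiplying the exponent matrix by its adjugate eliminates one variable at a time and leaves the
    determinant as exponent. *)
Lemma cramer_torsion (C : fieldType) (x y : C) k (i j l m : int) :
  x != 0 -> y != 0 ->
  (x ^ i * y ^ j) ^+ k = 1 -> (x ^ l * y ^ m) ^+ k = 1 ->
  x ^+ (k * absz (i * m - l * j)%R) = 1 /\ y ^+ (k * absz (i * m - l * j)%R) = 1.
Proof.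
move=> x0 y0; rewrite !exprnP => r1 r2.
have abs_exp (u : C) (D : int) : u ^ (k%:Z * D) = 1 -> u ^+ (k * absz D) = 1.
  case: D => D; rewrite ?NegzE ?abszN ?absz_nat ?mulrN -?exprnP //.
  by rewrite -invr_expz => /(congr1 GRing.inv); rewrite invrK invr1.
have comb (u v : int) : ((x ^ i * y ^ j) ^ k%:Z) ^ u * ((x ^ l * y ^ m) ^ k%:Z) ^ v =
    x ^ (k%:Z * (i * u + l * v)) * y ^ (k%:Z * (j * u + m * v)).
  rewrite !expfzMl !exprz_exp mulrACA -!expfzDr //.
  by congr (_ ^ _ * _ ^ _); ring.
split; apply: abs_exp.
  have := comb m (- j); rewrite r1 r2 !exp1rz mulr1.
  have -> : j * m + m * - j = 0 by ring.
  by rewrite mulr0 expr0z mulr1 mulrN => <-.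
have := comb (- l) i; rewrite r1 r2 !exp1rz mulr1.
have -> : i * - l + l * i = 0 by ring.
by rewrite mulr0 expr0z mul1r => ->; congr (_ ^ (_ * _)); ring.
Qed.

(** A relation gives [u ^+ k = 1] for the quotient [u] of its monomials. Two with the same [k] and
    independent exponent vectors, of determinant [D] up to sign, make [k * D] a common exponent of
    [x] and [y]. *)
Definition bounds_order n (r : seq relation) : bool :=
  has (fun q => has (fun q' =>
    [&& q.1.1 == q'.1.1, (0 < cramer_det q q')%N &
        (q.1.1 * cramer_det q q' %| n)%N]) r) r.

Lemma bounds_orderP (C : fieldType) (x y : C) n r :
  x != 0 -> y != 0 -> {in r, forall q, satisfies x y q} ->
  bounds_order n r -> x ^+ n = 1 /\ y ^+ n = 1.
Proof.
move=> x0 y0 rP /hasP[q /rP qP] /hasP[q' /rP q'P] /and3P[].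
move=> /eqP kk' _ /dvdnP[m ->] {n r rP}.
have to_unit n d e : satisfies x y (n, d, e) ->
    (x ^ (d.1%:Z - e.1%:Z) * y ^ (d.2%:Z - e.2%:Z)) ^+ n = 1.
  move=> de; have {}de : monomial x y d ^+ n = monomial x y e ^+ n.
    by move: de => /=; case: eqP => [->|_] -> //; rewrite sqrrN.
  have e0 : monomial x y e ^+ n != 0.
    by rewrite expf_neq0 // mulf_neq0 ?expf_neq0.
  transitivity ((monomial x y d / monomial x y e) ^+ n); last first.
    by rewrite expr_div_n de divff.
  by rewrite /monomial !expfzDr // -!invr_expz -!exprnP invfM mulrACA.
case: q q' qP q'P kk' => [[k a] b] [[k' c] d] qP q'P /= kk'.
rewrite -kk' in q'P.
have [xD yD] := cramer_torsion x0 y0 (to_unit _ _ _ qP) (to_unit _ _ _ q'P).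
by rewrite !(mulnC m) !(exprM _ _ m) xD yD !expr1n.
Qed.

(** The block of the constant term is put first, whence the leading [true]. The last alternative
    covers the pairing of 1 with x^3y^3, x with x^3y^2, y with x^2y^3: its quotients are all powers
    of xy, so no order is bounded. *)
Lemma split_relations_check (b1 b2 b3 b4 b5 : bool) :
  let b := [:: true; b1; b2; b3; b4; b5] in
  ~~ all id b ->
  all (fun r => all (fun r' =>
    [|| bounds_order 60 (r ++ r'), bounds_order 14 (r ++ r') |
        all (mem (r ++ r')) [:: (2, (0, 0), (3, 3)); (2, (1, 0), (3, 2))]%N])
    (forced_relations (mask (map negb b) f_exponents)))
    (forced_relations (mask b f_exponents)).
Proof. by case: b1 b2 b3 b4 b5 => [] [] [] [] []; vm_compute. Qed.

(** * The order of a torsion zero *)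

Lemma dvdn30_or_large_prime n : (0 < n)%N ->
  (n %| 30)%N \/
  exists p, [/\ prime p, (p %| n)%N & (p %| n %/ p)%N || (6 < p)%N].
Proof.
move=> n_gt0.
have [/hasP[p]|/hasPn small] :=
    boolP (has (fun p => (p %| n %/ p)%N || (6 < p)%N) (primes n)).
  by rewrite mem_primes => /and3P[p_pr _ p_n] h; right; exists p.
left; apply/(dvdn_partP _ n_gt0) => p p_n.
have := small p p_n; rewrite negb_or -leqNgt => /andP[pNm p_le6].
move: p_n; rewrite mem_primes => /and3P[p_pr _ p_n].
have -> : (n`_p = p)%N.
  rewrite p_part; suff -> : logn p n = 1%N by rewrite expn1.
  apply/eqP.
  rewrite eqn_leq -pfactor_dvdn // expn1 p_n andbT leqNgt.
  apply: contra pNm => le2; rewrite dvdn_divRL // mulnn.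
  by rewrite pfactor_dvdn.
by move: p p_le6 p_pr {p_n pNm} => [|[|[|[|[|[|[|]]]]]]].
Qed.

Lemma monomial_root (A : comNzRingType) (z : A) a b e :
  monomial (z ^+ a) (z ^+ b) e = z ^+ (e.1 * a + e.2 * b).
Proof. by rewrite /monomial -!exprM -exprD !(mulnC _ e.1) !(mulnC _ e.2). Qed.

Lemma norm_root_unity (C : numDomainType) (x : C) n :
  (0 < n)%N -> x ^+ n = 1 -> `|x| = 1.
Proof.
move=> n_gt0 xn1; apply/eqP; rewrite -(@pexpr_eq1 _ _ n) //.
by rewrite -normrX xn1 normr1.
Qed.

Lemma proper_split_torsion (C : numClosedFieldType) (x y : C)
    (b1 b2 b3 b4 b5 : bool) :
  let b := [:: true; b1; b2; b3; b4; b5] in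
  `|x| = 1 -> `|y| = 1 -> ~~ all id b ->
  \sum_(e <- mask b f_exponents) monomial x y e = 0 ->
  \sum_(e <- mask (map negb b) f_exponents) monomial x y e = 0 ->
  (x ^+ 60 = 1 /\ y ^+ 60 = 1) \/ (x ^+ 14 = 1 /\ y ^+ 14 = 1).
Proof.
move=> b x1 y1 b_proper /(forced_relationsP x1 y1)[r r_in rP].
move=> /(forced_relationsP x1 y1)[r' r'_in r'P].
have := split_relations_check b_proper.
move=> /allP/(_ _ r_in)/allP/(_ _ r'_in).
have {r_in r'_in}rr'P : {in r ++ r', forall q, satisfies x y q}.
  by move=> q; rewrite mem_cat => /orP[/rP|/r'P].
have x0 := norm1_neq0 x1; have y0 := norm1_neq0 y1.
case/or3P => [/(bounds_orderP x0 y0 rr'P)|/(bounds_orderP x0 y0 rr'P)|].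
- by left.
- by right.
rewrite /= andbT => /andP[/rr'P /= h1 /rr'P /= h2].
(* With [u = x * y] the relations say [u ^+ 3 = -1] and [u ^+ 2 = -1]; hence [u = 1], and then
   [1 = -1]. *)
have u3 : (x * y) ^+ 3 = -1.
  by move: h1; rewrite /monomial /= !expr0 mulr1 exprMn => ->; rewrite opprK.
have u2 : (x * y) ^+ 2 = -1.
  apply: (mulfI x0); rewrite mulrN1.
  transitivity (x ^+ 3 * y ^+ 2); first by rewrite exprMn mulrA -exprS.
  move: h2; rewrite /monomial /= expr0 mulr1 expr1 => h2.
  by rewrite [in RHS]h2 opprK.
have u1 : x * y = 1.
  by move: u3; rewrite exprS u2 mulrN1 => /oppr_inj.
move/eqP: u2; rewrite u1 expr1n -subr_eq0 opprK => /eqP.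
by move/eqP; rewrite -(natrD _ 1 1) pnatr_eq0.
Qed.

Lemma torsion_zero_order (C : numClosedFieldType) (x y : C) :
  (forall n, (0 < n)%N -> exists z : C, n.-primitive_root z) ->
  (exists n, [/\ (0 < n)%N, x ^+ n = 1 & y ^+ n = 1]) ->
  \sum_(e <- f_exponents) monomial x y e = 0 ->
  (x ^+ 60 = 1 /\ y ^+ 60 = 1) \/ (x ^+ 14 = 1 /\ y ^+ 14 = 1).
Proof.
move=> prim_exists xy_torsion fxy0.
have /ex_minnP[n /and3P[n_gt0 /eqP xn1 /eqP yn1] n_min] :
    exists n, [&& (0 < n)%N, x ^+ n == 1 & y ^+ n == 1].
  by case: xy_torsion => n [n_gt0 /eqP ? /eqP ?]; exists n; apply/and3P.
have x1 := norm_root_unity n_gt0 xn1; have y1 := norm_root_unity n_gt0 yn1.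
have [n30|[p [p_pr p_n p_large]]] := dvdn30_or_large_prime n_gt0.
  have /dvdnP[m ->] : (n %| 60)%N by apply: dvdn_trans n30 _.
  by left; rewrite !(mulnC m) !exprM xn1 yn1 !expr1n.
have [z prim_z] := prim_exists n n_gt0.
have /(prim_rootP prim_z)[a xE] := xn1; have /(prim_rootP prim_z)[b yE] := yn1.
pose P (e : nat * nat) := (e.1 * a + e.2 * b == 0 %[mod p])%N.
have sumP : \sum_(e <- f_exponents | P e) monomial x y e = 0.
  pose h (e : nat * nat) := (e.1 * a + e.2 * b)%N.
  have := @vanishing_sum_residue_class _ n p z (map h f_exponents) 0 p_pr prim_z p_n.
  rewrite !big_map; under eq_bigr do rewrite -monomial_root -xE -yE.
  under [in X in _ -> _ -> X = 0]eq_bigr do rewrite -monomial_root -xE -yE.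
  exact.
have sumNP : \sum_(e <- f_exponents | ~~ P e) monomial x y e = 0.
  by move: fxy0; rewrite (bigID P) /= sumP add0r.
rewrite -big_filter filter_mask in sumP; rewrite -big_filter filter_mask in sumNP.
have P00 : P (0, 0)%N by rewrite /P.
move: sumP sumNP; rewrite /= P00; apply: proper_split_torsion => //=.
(* If all six exponents were 0 modulo [p], the monomials x and y would give [p %| a] and [p %| b],
   and [n %/ p] would be a smaller common exponent. *)
apply/negP => /and5P[P10 P01 _ _ _].
have root_p c (t : C) : (p %| c)%N -> t = z ^+ c -> t ^+ (n %/ p) = 1.
  move=> /dvdnP[d ->] ->; rewrite -exprM -mulnA [(p * _)%N]mulnC divnK // mulnC.
  by rewrite exprM (prim_expr_order prim_z) expr1n.
have pa : (p %| a)%N.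
  by move: P10; rewrite /P mul1n mul0n addn0 mod0n.
have pb : (p %| b)%N.
  by move: P01; rewrite /P mul1n mul0n add0n mod0n.
have := n_min (n %/ p)%N; rewrite (root_p _ _ pa xE) (root_p _ _ pb yE) !eqxx.
rewrite divn_gt0 ?prime_gt0 // dvdn_leq // => /(_ isT).
by rewrite leqNgt ltn_Pdiv ?prime_gt1.
Qed.

(** * Finite search modulo a prime *)

Definition powers_mod (p g n : nat) : seq nat :=
  traject (fun t => (t * g) %% p)%N 1%N n.

Lemma nth_powers_mod p g n k :
  (1 < p)%N -> (k < n)%N -> nth 0%N (powers_mod p g n) k = (g ^ k %% p)%N.
Proof.
move=> p_gt1 k_lt; rewrite (set_nth_default 1%N) ?size_traject // nth_traject //.
elim: k {k_lt} => [|k IHk].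
  by rewrite modn_small.
by rewrite iterS IHk modnMml -expnSr.
Qed.

Definition sum_mod (pw : seq nat) (n a b : nat) : nat :=
  sumn [seq nth 0 pw ((e.1 * a + e.2 * b) %% n) | e <- f_exponents]%N.

(** The first four tests certify that [g] has order [n] modulo the prime [p]; the table has [n.+1]
    entries so that [g ^ n] can be read off it. The factor [d] turns exponents of [z ^+ d] into
    exponents of [z]. *)
Definition search_check (n p g d : nat) (l : seq (nat * nat)) : bool :=
  let pw := powers_mod p g n.+1 in
  [&& prime p, (0 < n)%N, nth 0%N pw n == 1%N,
      all (fun k => nth 0%N pw k != 1%N) (iota 1 n.-1) &
      all (fun a => all (fun b =>
        ~~ (p %| sum_mod pw n a b)%N || ((d * a, d * b)%N \in l))
        (iota 0 n)) (iota 0 n)].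

(* Reduction modulo a prime [p] with an element [g] of order [n] turns the
   search for the zeros of order [n] into a finite computation. *)
Lemma torsion_zero_search (C : numFieldType) n p g d (z x y : C) l :
  search_check n p g d l -> (d * n).-primitive_root z ->
  x ^+ n = 1 -> y ^+ n = 1 ->
  \sum_(e <- f_exponents) monomial x y e = 0 ->
  exists2 ab, ab \in l & x = z ^+ ab.1 /\ y = z ^+ ab.2.
Proof.
case/and5P => p_pr n_gt0 /eqP gn gk search prim_z xn1 yn1.
have pw k : (k < n.+1)%N -> _ := nth_powers_mod g (prime_gt1 p_pr).
have prim_g : n.-primitive_root (g%:R : 'F_p).
  have gE k : (k <= n)%N -> (g%:R : 'F_p) ^+ k =
      (nth 0%N (powers_mod p g n.+1) k)%:R.
    by move=> k_le; rewrite pw // (Fp_nat_mod p_pr) natrX.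
  apply: prim_root_intro => // [|k /andP[k_gt0 k_lt]]; first by rewrite gE // gn.
  have := allP gk k; rewrite mem_iota k_gt0 add1n prednK // => /(_ k_lt).
  rewrite pw; last by rewrite ltnS ltnW.
  apply: contra => /eqP; rewrite -natrX -[1]/(1%:R) => /(congr1 (@nat_of_ord _)).
  by rewrite !(val_Fp_nat p_pr) => ->; rewrite modn_small ?prime_gt1.
have n_d : (n %| d * n)%N by rewrite dvdn_mull.
have prim_zd : n.-primitive_root (z ^+ d).
  by have := dvdn_prim_root prim_z n_d; rewrite mulnK.
have [a xE] := prim_rootP prim_zd xn1; have [b yE] := prim_rootP prim_zd yn1.
rewrite xE yE; under eq_bigr do rewrite monomial_root.
rewrite -(big_map (fun e => e.1 * a + e.2 * b)%N xpredT (fun k => (z ^+ d) ^+ k)).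
(* Every zero thus yields a zero modulo [p] with the same exponents, and the search has listed all
   of those. *)
move/(prim_root_sum_transfer prim_zd prim_g) => sum0.
have := allP (allP search a _) b _; rewrite !mem_iota /= !add0n.
move=> /(_ (ltn_ord _) (ltn_ord _))/orP[/negP[]|ab_l]; last first.
  by exists (d * a, d * b)%N; rewrite // !exprM.
rewrite (dvdn_pcharf (pchar_Fp p_pr)) /sum_mod sumnE natr_sum.
apply/eqP; rewrite -[RHS]sum0 !big_map; apply: eq_bigr => e _.
rewrite pw; last by rewrite ltnS ltnW ?ltn_pmod.
by rewrite (Fp_nat_mod p_pr) natrX (prim_expr_mod prim_g).
Qed.

(* The four blocks are the sets [S0], [S1], [S2], [S3], with [z ^+ 140],
   [z ^+ 84], [z ^+ 60] and [z ^+ 210] in the roles of [alpha], [beta], [gamma]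
   and [-1]. *)
Definition torsion_exponents : seq (nat * nat) :=
  ([:: (0, 210); (210, 0)] ++
   [:: (140, 140); (280, 140); (140, 280); (280, 280);
       (140, 350); (350, 140); (280, 70); (70, 280)] ++
   [:: (224, 364); (364, 224); (308, 28); (28, 308);
       (392, 112); (112, 392); (56, 196); (196, 56)] ++
   [:: (60, 30); (120, 270); (180, 90); (240, 330); (300, 150); (360, 390);
       (270, 120); (330, 240); (390, 360); (30, 60); (90, 180); (150, 300)])%N.

(* 29 and 421 are chosen so that no spurious zero appears modulo [p]. *)
Lemma search_check14 : search_check 14 29 4 30 torsion_exponents.
Proof. by vm_compute. Qed.

Lemma search_check60 : search_check 60 421 34 7 torsion_exponents.
Proof. by vm_compute. Qed.

(** 420 is the least common multiple of 60 and 14, so one root serves both searches. *)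
Lemma torsion_zero_exponents (C : numClosedFieldType) (z x y : C) :
  (forall n, (0 < n)%N -> exists z : C, n.-primitive_root z) ->
  420.-primitive_root z ->
  (exists n, [/\ (0 < n)%N, x ^+ n = 1 & y ^+ n = 1]) ->
  \sum_(e <- f_exponents) monomial x y e = 0 ->
  exists2 ab, ab \in torsion_exponents & x = z ^+ ab.1 /\ y = z ^+ ab.2.
Proof.
move=> prim_exists prim_z xy_torsion fxy0.
have prim_z60 : (7 * 60).-primitive_root z by [].
have prim_z14 : (30 * 14).-primitive_root z by [].
case: (torsion_zero_order prim_exists xy_torsion fxy0) => -[xn yn].
  exact: torsion_zero_search search_check60 prim_z60 xn yn fxy0.
exact: torsion_zero_search search_check14 prim_z14 xn yn fxy0.
Qed.

(** * The listed pairs are zeros *)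

Lemma prim_root_half (F : idomainType) n (z : F) :
  (0 < n)%N -> (n * 2).-primitive_root z -> z ^+ n = -1.
Proof.
move=> n_gt0 prim_z; have prim2 : 2.-primitive_root (z ^+ n).
  by have := dvdn_prim_root prim_z (dvdn_mull n (dvdnn 2)); rewrite mulnK.
have /eqP := prim_expr_order prim2; rewrite -subr_eq0 subr_sqr_1 mulf_eq0.
rewrite subr_eq0 addr_eq0 => /orP[/eqP z1|/eqP //].
by have := prim_order_dvd prim2 1; rewrite expr1 z1 eqxx.
Qed.

(* Greedy search for a decomposition into pairs [e, e + 210] of opposite powers
   and triples [e, e + 140, e + 280] differing by cube roots of unity. *)
Fixpoint cancels (k : nat) (s : seq nat) : bool :=
  if k isn't k'.+1 then nilp s else
  if s isn't e :: s' then true else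
  let e2 := ((e + 210) %% 420)%N in
  let e3 := ((e + 140) %% 420)%N in
  let e3' := ((e + 280) %% 420)%N in
  if e2 \in s' then cancels k' (rem e2 s')
  else [&& e3 \in s', e3' \in rem e3 s' & cancels k' (rem e3' (rem e3 s'))].

Lemma cancelsP (F : idomainType) (z : F) k s :
  420.-primitive_root z -> cancels k s -> \sum_(e <- s) z ^+ e = 0.
Proof.
move=> prim_z; have zmod := prim_expr_mod prim_z.
have zN : z ^+ 210 = -1 by apply: prim_root_half.
have z3 : 1 + z ^+ 140 + z ^+ 280 = 0.
  have prim3 : 3.-primitive_root (z ^+ 140) by apply: (dvdn_prim_root prim_z).
  have := sum_expr_root_unity (prim_expr_order prim3).
  rewrite -[_ == 1]/(_ ^+ 1 == 1) -(prim_order_dvd prim3) /= => <-.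
  by rewrite !big_ord_recr big_ord0 /= add0r expr0 expr1 -exprM.
elim: k s => [|k IHk] [|e s] //=; rewrite ?big_nil // big_cons.
case: ifP => [e2_s /IHk|_ /and3P[e3_s e3'_s /IHk]].
  rewrite (perm_big _ (perm_to_rem e2_s)) big_cons /= => ->.
  by rewrite zmod exprD zN mulrN1 addr0 subrr.
rewrite (perm_big _ (perm_to_rem e3_s)) big_cons /=.
rewrite (perm_big _ (perm_to_rem e3'_s)) big_cons /= => ->.
transitivity (z ^+ e * (1 + z ^+ 140 + z ^+ 280)); last by rewrite z3 mulr0.
by rewrite !zmod !exprD addr0 addrA !mulrDr mulr1.
Qed.

Lemma torsion_exponents_zero (F : idomainType) (z : F) ab :
  420.-primitive_root z -> ab \in torsion_exponents ->
  \sum_(e <- f_exponents) monomial (z ^+ ab.1) (z ^+ ab.2) e = 0.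
Proof.
move=> prim_z ab_in.
(* Six terms fall into three pairs or two triples, so fuel 3 suffices. *)
have check : all (fun ab => cancels 3
    [seq (e.1 * ab.1 + e.2 * ab.2) %% 420 | e <- f_exponents]%N)
    torsion_exponents by vm_compute.
rewrite -[RHS](cancelsP prim_z (allP check _ ab_in)) big_map.
by apply: eq_bigr => e _; rewrite monomial_root (prim_expr_mod prim_z).
Qed.

Local Open Scope classical_set_scope.
Local Open Scope complex_scope.

(** * Roots of unity from the complex exponential *)

Section ComplexRoots.

Variable R : realType.

Lemma cexp_pureX (t : R) n : (cexp (0 +i* t)) ^+ n = cexp (0 +i* (t *+ n)).
Proof.
rewrite /cexp /= expR0 !mul1r.
elim: n => [|n IHn]; first by rewrite mulr0n cos0 sin0.
rewrite exprS IHn mulrS cosD sinD; apply/eqP; rewrite eq_complex /=.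
by apply/andP; split; apply/eqP; ring.
Qed.

Definition unit_root (n : nat) : R[i] := cexp (0 +i* (2 * pi / n%:R)).

Lemma unit_root_prim n : (0 < n)%N -> n.-primitive_root (unit_root n).
Proof.
move=> n_gt0; have n0 : n%:R != 0 :> R by rewrite pnatr_eq0 -lt0n.
apply: prim_root_intro => // [|k /andP[k_gt0 k_lt]].
  rewrite cexp_pureX -[_ *+ n]mulr_natr divfK // mulrC mulr_natr.
  by rewrite /cexp /= expR0 cos2pi sin2pi mul1r.
rewrite cexp_pureX; apply/eqP; rewrite /cexp /= expR0 mul1r => -[cos1 _].
(* Halve the angle: [pi * (k / n)] lies strictly between 0 and [pi], where the sine is positive,
   while cosine 1 at the double angle forces it to be 0. *)
have tE : 2 * pi / n%:R *+ k = (pi * (k%:R / n%:R)) *+ 2 :> R.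
  by rewrite -[LHS]mulr_natr -[RHS]mulr_natr; ring.
have /lt0r_neq0/eqP[] : 0 < sin (pi * (k%:R / n%:R) : R).
  apply: sin_gt0_pi; rewrite mulr_gt0 ?pi_gt0 ?divr_gt0 ?ltr0n //=.
  by rewrite gtr_pMr ?pi_gt0 // ltr_pdivrMr ?ltr0n // mul1r ltr_nat.
apply/eqP; rewrite -sqrf_eq0 sin2cos2.
move: cos1; rewrite tE cos_mulr2n => /eqP.
rewrite subr_eq -mulr2n -subr_eq0 -mulrnBl mulrn_eq0 /= subr_eq0 => /eqP ->.
by rewrite subrr.
Qed.

Lemma unit_rootX n d : (0 < n)%N -> (0 < d)%N ->
  unit_root (n * d) ^+ d = unit_root n.
Proof.
move=> n_gt0 d_gt0; rewrite cexp_pureX; congr (cexp (_ +i* _)).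
by rewrite natrM -[LHS]mulr_natr; field; rewrite !pnatr_eq0 -!lt0n n_gt0.
Qed.

Lemma f_evalE (x y : R[i]) :
  f_eval x y = \sum_(e <- f_exponents) monomial x y e.
Proof.
rewrite /f_eval /f !rmorphD !rmorphM rmorph1 /=.
rewrite map_polyC /= !map_polyX !hornerE.
by rewrite !big_cons big_nil /monomial /=; ring.
Qed.

End ComplexRoots.

(** * Matching the exponent list with S, and counting *)

Definition power_pair (A : nzRingType) (z : A) (ab : nat * nat) : A * A :=
  (z ^+ ab.1, z ^+ ab.2).

(** All listed exponents lie below 420, the order of [z]. Hence counting S amounts to counting a
    duplicate-free list. *)
Lemma power_pair_inj (A : nzRingType) (z : A) : 420.-primitive_root z ->
  {in [set` torsion_exponents] &, injective (power_pair z)}.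
Proof.
move=> prim_z [a b] [c d]; rewrite !inE /= => ab_in cd_in [ac bd].
have lt420 e : e \in torsion_exponents -> (e.1 < 420)%N && (e.2 < 420)%N.
  have check : all (fun e => (e.1 < 420)%N && (e.2 < 420)%N) torsion_exponents.
    by vm_compute.
  exact: (allP check).
have /andP[/= a_lt b_lt] := lt420 _ ab_in.
have /andP[/= c_lt d_lt] := lt420 _ cd_in.
move/eqP: ac; move/eqP: bd; rewrite !(eq_prim_root_expr prim_z).
by rewrite !modn_small // => /eqP-> /eqP->.
Qed.

Section TorsionPowers.

Variables (R : realType) (z : R[i]).
Hypotheses (prim_z : 420.-primitive_root z) (aE : alpha R = z ^+ 140)
  (bE : beta R = z ^+ 84) (cE : gamma R = z ^+ 60).

Let point := power_pair z.

Let setU_congr (A B A' B' : set (R[i] * R[i])) :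
  A = A' -> B = B' -> A `|` B = A' `|` B'.
Proof. by move=> -> ->. Qed.

Let point_congr (u v : R[i]) i j : u = z ^+ i -> v = z ^+ j ->
  [set (u, v)] = [set point (i, j)].
Proof. by move=> -> ->. Qed.

Ltac split_unions :=
  repeat lazymatch goal with |- _ `|` _ = _ => apply: setU_congr end;
  apply: point_congr.

(** Both sides list the points in the same order, so the unions match term by term. What remains are
    congruences of exponents modulo 420, with -1 read as [z ^+ 210]. *)
Lemma torsionS_image : torsionS R = point @` [set` torsion_exponents].
Proof.
have image_nil : point @` [set` [::]] = set0.
  by apply/seteqP; split=> // y [].
have image_cons ab s :
    point @` [set` ab :: s] = [set point ab] `|` point @` [set` s].
  rewrite -image_set1 -image_setU; congr (_ @` _).
  by apply/seteqP; split=> y /=; rewrite inE => /predU1P.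
have set_cat (s t : seq (nat * nat)) : [set` s ++ t] = [set` s] `|` [set` t].
  by apply/seteqP; split=> y /=; rewrite mem_cat => /orP.
have z210 : z ^+ 210 = -1 by apply: prim_root_half.
have zN k : - z ^+ k = z ^+ (k + 210) by rewrite exprD z210 mulrN1.
have z_eq i j : (i == j %[mod 420])%N -> z ^+ i = z ^+ j.
  by move=> ij; apply/eqP; rewrite (eq_prim_root_expr prim_z).
have S2_range : [set j | (1 <= j <= 4)%N] = [set 1; 2; 3; 4]%N.
  apply/seteqP; split=> [|j /=]; last by move=> [[[->|->]|->]|->].
  by move=> [|[|[|[|[|j]]]]] //= _; do ?[by right|left].
rewrite /torsion_exponents !set_cat !image_setU !setUA.
congr (_ `|` _ `|` _ `|` _).
- rewrite /S0 !image_cons image_nil setU0; split_unions;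
    by rewrite ?expr0 ?z210.
- rewrite /S1 /= aE !image_cons image_nil setU0 !setUA; split_unions;
    by rewrite -?exprM ?zN; apply: z_eq.
- rewrite /S2 S2_range !bigcup_setU !bigcup_set1 aE bE.
  rewrite !image_cons image_nil setU0 !setUA; split_unions;
    by rewrite -?exprM -?exprD; apply: z_eq.
- rewrite /S3 /= cE !image_cons image_nil setU0 !setUA; split_unions;
    by rewrite -?exprM ?zN; apply: z_eq.
Qed.

End TorsionPowers.

Lemma unit_root420_image (R : realType) :
  torsionS R = power_pair (unit_root R 420) @` [set` torsion_exponents].
Proof.
have root_dvd n d : (0 < n)%N -> (0 < d)%N -> (n * d = 420)%N ->
    unit_root R n = unit_root R 420 ^+ d.
  by move=> n_gt0 d_gt0 <-; rewrite unit_rootX.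
apply: torsionS_image; first exact: unit_root_prim.
- by rewrite -(root_dvd 3).
- by rewrite -(root_dvd 5).
- by rewrite -(root_dvd 7).
Qed.

Lemma card_torsionS (R : realType) : (torsionS R #= `I_30)%card.
Proof.
have pair_inj := power_pair_inj (unit_root_prim R (isT : (0 < 420)%N)).
rewrite unit_root420_image; apply: card_eq_trans (inj_card_eq pair_inj) _.
have nth_inj : {in `I_30 &, injective (nth (0, 0)%N torsion_exponents)}.
  move=> i j; rewrite !inE /= => i_lt j_lt /eqP.
  by rewrite nth_uniq // => /eqP.
have -> : [set` torsion_exponents] = nth (0, 0)%N torsion_exponents @` `I_30.
  apply/seteqP; split=> [e /= e_in|_ [i /= i_lt <-]]; last exact: mem_nth.
  exists (index e torsion_exponents); last exact: nth_index.
  by rewrite /= -index_mem in e_in *.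
exact: inj_card_eq.
Qed.

Lemma torsion_zerosE (R : realType) :
  [set p : R[i] * R[i] |
     f_eval p.1 p.2 = 0 /\
     exists N : nat, (0 < N)%N /\ p.1 ^+ N = 1 /\ p.2 ^+ N = 1]
  = torsionS R.
Proof.
have prim_z := unit_root_prim R (isT : (0 < 420)%N).
rewrite unit_root420_image; apply/seteqP.
split=> [[x y] /= []|_ [ab /= ab_in <-] /=].
  rewrite f_evalE => fxy0 [n [n_gt0 [xn1 yn1]]].
  have prim_exists m : (0 < m)%N -> exists t : R[i], m.-primitive_root t.
    by move=> m_gt0; exists (unit_root R m); apply: unit_root_prim.
  have [|ab ab_in [-> ->]] := torsion_zero_exponents prim_exists prim_z _ fxy0.
    by exists n.
  by exists ab.
rewrite f_evalE torsion_exponents_zero //; split=> //; exists 420%N.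
by rewrite -!exprM ![(_ * 420)%N]mulnC !exprM (prim_expr_order prim_z) !expr1n.
Qed.

Theorem mainTheorem1 (R : realType) :
  (torsionS R #= `I_30)%card /\
  [set p : R[i] * R[i] |
     f_eval p.1 p.2 = 0 /\
     exists N : nat, (0 < N)%N /\ p.1 ^+ N = 1 /\ p.2 ^+ N = 1]
  = torsionS R.
Proof. by split; [exact: card_torsionS | exact: torsion_zerosE]. Qed.
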